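(* Suppose that the measure preserving system $(X,\mathcal{X},\mu,T)$ has an under-recurrent function. Then it also has a strictly over-recurrent function. Furthermore, if the real valued sequence $(a_n)_{n\in\mathbb{N}}$ is either absolutely summable or decreases convexly to $0$, then there exists $f\in L^2(\mu)$ such that $$\int f\cdot T^nf\,d\mu-\Big(\int f\,d\mu\Big)^2=a_n\quad\text{for every } n\in\mathbb{N}.$$
   Context: A measure preserving system is a quadruple $(X,\mathcal{X},\mu,T)$ where $(X,\mathcal{X},\mu)$ is a probability space and $T\colon X\to X$ is a measure preserving transformation. All functions are real valued and $T^nf$ denotes $f\circ T^n$. $\mathbb{N}=\{1,2,\ldots\}$. A function $f\in L^2(\mu)$ is under-recurrent if it is non-constant (modulo $\mu$-null sets) and $\int f\cdot T^nf\,d\mu\leq\left(\int f\,d\mu\right)^2$ for every $n\in\mathbb{N}$; it is strictly over-recurrent if it is non-constant and $\int f\cdot T^nf\,d\mu>\left(\int f\,d\mu\right)^2$ for every $n\in\mathbb{N}$. A real sequence $(a_n)_{n\in\mathbb{N}}$ decreases convexly to $0$ if it converges to $0$ and satisfies $a_{n-1}+a_{n+1}-2a_n\geq 0$ for every $n\geq 2$. *)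

(* Defs.v *)
From mathcomp Require Import all_boot all_order all_algebra.
From mathcomp Require Import all_classical all_reals all_analysis.
Import Order.TTheory GRing.Theory Num.Theory.
Import numFieldNormedType.Exports.

Set Implicit Arguments.
Unset Strict Implicit.
Unset Printing Implicit Defensive.

Local Open Scope classical_set_scope.
Local Open Scope ring_scope.

(* T is not assumed to be invertible. *)
Definition measure_preserving (R : realType) (d : measure_display)
    (X : measurableType d) (mu : probability X R) (T : X -> X) : Prop :=
  measurable_fun [set: X] T /\
  forall A : set X, measurable A -> mu (T @^-1` A) = mu A.

Definition nonconstant (R : realType) (d : measure_display)
    (X : measurableType d) (mu : probability X R) (f : X -> R) : Prop :=
  ~ exists c : R, {ae mu, forall x, f x = c}.

(* The integrals are real-valued; they are finite whenever f is in L^2(mu),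
   since mu is a T-invariant probability. *)
Definition correlation (R : realType) (d : measure_display)
    (X : measurableType d) (mu : probability X R) (T : X -> X)
    (f : X -> R) (n : nat) : R :=
  \int[mu]_x (f x * f (iter n T x)).

Definition under_recurrent (R : realType) (d : measure_display)
    (X : measurableType d) (mu : probability X R) (T : X -> X)
    (f : X -> R) : Prop :=
  [/\ f \in Lfun mu 2%:E, nonconstant mu f &
      forall n : nat, (1 <= n)%N ->
        correlation mu T f n <= (\int[mu]_x f x) ^+ 2].

Definition strictly_over_recurrent (R : realType) (d : measure_display)
    (X : measurableType d) (mu : probability X R) (T : X -> X)
    (f : X -> R) : Prop :=
  [/\ f \in Lfun mu 2%:E, nonconstant mu f &
      forall n : nat, (1 <= n)%N ->
        (\int[mu]_x f x) ^+ 2 < correlation mu T f n].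

(* Sequences (a_n) indexed by n >= 1 are functions on nat whose value at 0 is
   irrelevant. *)
Definition absolutely_summable (R : realType) (a : nat -> R) : Prop :=
  summable [set n : nat | (1 <= n)%N] (EFin \o a).

Definition decreases_convexly_to_0 (R : realType) (a : nat -> R) : Prop :=
  a n @[n --> \oo] --> (0 : R) /\
  forall n : nat, (2 <= n)%N -> 0 <= a n.-1 + a n.+1 - 2 * a n.

(* Main.v *)
Require Import Defs.
From mathcomp Require Import all_boot all_order all_algebra.
From mathcomp Require Import all_classical all_reals all_analysis.
From mathcomp Require Import measurable_realfun.
From mathcomp Require Import ring lra.
Import Order.TTheory GRing.Theory Num.Theory.
Import numFieldNormedType.Exports.

Set Implicit Arguments.
Unset Strict Implicit.
Unset Printing Implicit Defensive.

Local Open Scope classical_set_scope.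
Local Open Scope ring_scope.

(** Under-recurrence makes the correlations [<f, T^n f>], [n >= 1], of the centered
    function nonpositive; comparing with the norms of the ergodic sums, their sum is at
    least [- |f|^2 / 2], and then [f] stays at squared distance at least [|f|^2 / 2]
    from the closed span of [T f, T^2 f, ...].  The innovation [e] of [f] (Wold
    decomposition) is thus nonzero, and [e, T e, T^2 e, ...] are pairwise orthogonal.

    It remains to find coefficients [d_k] with [\sum_k d_k d_(k+n) = a_n] for [n >= 1].
    Both kinds of sequences satisfy [a_n = \sum_k (autocorrelation of y_k at n)] with
    finite sequences [y_k]: two-point sequences for a summable [a], multiples of
    indicators of intervals for a convex [a].  Placing the [y_k] on disjoint copies of
    [nat], inside the orthonormal system just found, gives a stationary sequence [Y] with
    correlations [a_n].  As all [y_k] are one-sided, [Y] has no component in the remote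
    future, so [Y_n = \sum_k d_k eps_(n+k)] for its innovations [eps]; replacing [eps_k]
    by [T^k e] gives the function sought. *)

(** * Real semi-inner product spaces *)

(** Definiteness is not asked for: elements of [L^2] are kept as functions, not as classes modulo
    null sets, so a nonzero vector may have norm 0. *)
Record semi_inner (R : realType) (V : lmodType R) := SemiInner {
  form :> V -> V -> R;
  formC : forall x y, form x y = form y x;
  formDl : forall x y z, form (x + y) z = form x z + form y z;
  formZl : forall (a : R) x z, form (a *: x) z = a * form x z;
  form_ge0 : forall x, 0 <= form x x }.

Section SemiInner.
Context {R : realType} {V : lmodType R} (B : semi_inner V).
Implicit Types (x y z : V) (u v : nat -> V).

Lemma formDr x y z : B x (y + z) = B x y + B x z.
Proof. by rewrite formC formDl !(formC B x). Qed.

Lemma formZr (a : R) x y : B x (a *: y) = a * B x y.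
Proof. by rewrite formC formZl formC. Qed.

Lemma formNl x y : B (- x) y = - B x y.
Proof. by rewrite -scaleN1r formZl mulN1r. Qed.

Lemma formNr x y : B x (- y) = - B x y.
Proof. by rewrite formC formNl formC. Qed.

Lemma formBl x y z : B (x - y) z = B x z - B y z.
Proof. by rewrite formDl formNl. Qed.

Lemma formBr x y z : B x (y - z) = B x y - B x z.
Proof. by rewrite formDr formNr. Qed.

Lemma form0l x : B 0 x = 0.
Proof. by rewrite -(scale0r 0) formZl mul0r. Qed.

Lemma form0r x : B x 0 = 0.
Proof. by rewrite formC form0l. Qed.

Lemma form_suml (I : Type) (r : seq I) (P : pred I) (F : I -> V) y :
  B (\sum_(i <- r | P i) F i) y = \sum_(i <- r | P i) B (F i) y.
Proof. by apply: (big_morph (B^~ y)) => [a b|]; rewrite ?formDl ?form0l. Qed.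

Lemma form_sumr (I : Type) (r : seq I) (P : pred I) (F : I -> V) x :
  B x (\sum_(i <- r | P i) F i) = \sum_(i <- r | P i) B x (F i).
Proof. by apply: (big_morph (B x)) => [a b|]; rewrite ?formDr ?form0r. Qed.

Lemma form_sqr_le x y : B x y ^+ 2 <= B x x * B y y.
Proof.
have := form_ge0 B y; rewrite le_eqVlt => /predU1P[y0|y0]; last first.
  have := form_ge0 B (B y y *: x - B x y *: y).
  rewrite !(formBl, formBr, formZl, formZr) (formC B y x) => h.
  by rewrite -(ler_pM2l y0); nra.
rewrite -y0 mulr0; have [->|b0] := eqVneq (B x y) 0; first by rewrite expr0n.
(* Since [B y y = 0], the square norm of [x - t *: y] is affine in [t]; this [t] would make it
   [- B x x - 2]. *)
have := form_ge0 B (x - ((B x x + 1) / B x y) *: y).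
rewrite !(formBl, formBr, formZl, formZr) (formC B y x) -y0 divfK//.
by rewrite !mulr0 subr0 => h; have := form_ge0 B x; lra.
Qed.

Lemma form_null_r x y : B y y = 0 -> B x y = 0.
Proof.
move=> y0; apply/eqP; rewrite -sqrf_eq0 eq_le sqr_ge0 andbT.
by have := form_sqr_le x y; rewrite y0 mulr0.
Qed.

Definition seminorm x := Num.sqrt (B x x).

Lemma seminorm_ge0 x : 0 <= seminorm x.
Proof. exact: sqrtr_ge0. Qed.

Lemma seminorm_sqr x : seminorm x ^+ 2 = B x x.
Proof. by rewrite sqr_sqrtr// form_ge0. Qed.

Lemma norm_form_le x y : `|B x y| <= seminorm x * seminorm y.
Proof.
rewrite -sqrtrM ?form_ge0// -sqrtr_sqr; apply: ler_wsqrtr; exact: form_sqr_le.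
Qed.

Lemma seminormD x y : seminorm (x + y) <= seminorm x + seminorm y.
Proof.
rewrite -(@ler_pXn2r _ 2) ?nnegrE ?addr_ge0 ?seminorm_ge0//.
rewrite sqrrD !seminorm_sqr formDl !formDr (formC B y x).
by have := le_trans (ler_norm _) (norm_form_le x y); lra.
Qed.

Lemma seminormN x : seminorm (- x) = seminorm x.
Proof. by rewrite /seminorm formNl formNr opprK. Qed.

Lemma seminormZ (a : R) x : seminorm (a *: x) = `|a| * seminorm x.
Proof.
by rewrite /seminorm formZl formZr mulrA -expr2 sqrtrM ?sqr_ge0// sqrtr_sqr.
Qed.

Definition cvg_semi u x := seminorm (u n - x) @[n --> \oo] --> (0 : R).

Definition cauchy_semi u := forall e : R, 0 < e ->
  exists N, forall m n, (N <= m)%N -> (N <= n)%N -> B (u m - u n) (u m - u n) < e.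

Definition complete_semi := forall u, cauchy_semi u -> exists x, cvg_semi u x.

Lemma cvg_semi_cst x : cvg_semi (fun=> x) x.
Proof.
rewrite /cvg_semi; under eq_fun do rewrite subrr /seminorm form0l sqrtr0.
exact: cvg_cst.
Qed.

Lemma cvg_semi_le u x (b : nat -> R) : b n @[n --> \oo] --> (0 : R) ->
  (forall n, seminorm (u n - x) <= b n) -> cvg_semi u x.
Proof.
move=> b0 ub; apply: (squeeze_cvgr _ (cvg_cst 0) b0).
by apply: nearW => n; rewrite seminorm_ge0 ub.
Qed.

Lemma cvg_semiD u v x y : cvg_semi u x -> cvg_semi v y ->
  cvg_semi (fun n => u n + v n) (x + y).
Proof.
move=> ux vy; apply: (@cvg_semi_le _ _ (fun n => seminorm (u n - x) + seminorm (v n - y))).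
  by rewrite -[0 : R](addr0 0); exact: cvgD.
by move=> n; rewrite opprD addrACA; exact: seminormD.
Qed.

Lemma cvg_semiZ (a : R) u x : cvg_semi u x -> cvg_semi (fun n => a *: u n) (a *: x).
Proof.
move=> ux; rewrite /cvg_semi; under eq_fun do rewrite -scalerBr seminormZ.
by rewrite -[0 : R](mulr0 `|a|); exact: cvgMr.
Qed.

Lemma cvg_form u v x y : cvg_semi u x -> cvg_semi v y ->
  B (u n) (v n) @[n --> \oo] --> B x y.
Proof.
move=> ux vy; apply/subr_cvg0.

have h : seminorm (u n - x) * (seminorm y + seminorm (v n - y)) +
   seminorm x * seminorm (v n - y) @[n --> \oo] --> 0 * (seminorm y + 0) + seminorm x * 0.
  apply: cvgD; last by apply: cvgMr.
  by apply: cvgM => //; apply: cvgD => //; exact: cvg_cst.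
rewrite mul0r mulr0 addr0 in h.
apply/norm_cvg0P; apply: (squeeze_cvgr _ (cvg_cst 0) h).
apply: nearW => n; rewrite normr_ge0/=.
have -> : B (u n) (v n) - B x y = B (u n - x) (v n) + B x (v n - y).
  by rewrite formBl formBr; ring.
apply: (le_trans (ler_normD _ _)); apply: lerD; last exact: norm_form_le.
apply: (le_trans (norm_form_le _ _)); apply: ler_wpM2l; first exact: seminorm_ge0.
by rewrite -{1}(subrK y (v n)) addrC; exact: seminormD.
Qed.

End SemiInner.

(** * Innovations of a stationary sequence *)

Section Wold.
Context {R : realType} {V : lmodType R} (B : semi_inner V).
Implicit Types (p q : {poly R}) (Y : nat -> V).

(** This is [p] evaluated at the shift and applied to [Y] at time [m]. Coding finite combinations by
    polynomials lets the same combination be taken at every time. *)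
Definition polyact Y p m : V := \sum_(i < size p) p`_i *: Y (m + i)%N.

Lemma polyact_widen Y p m N : (size p <= N)%N ->
  polyact Y p m = \sum_(i < N) p`_i *: Y (m + i)%N.
Proof.
move=> pN; rewrite /polyact (big_ord_widen N (fun i => p`_i *: Y (m + i)%N))//.
rewrite big_mkcond/=; apply: eq_bigr => i _; case: ltnP => // h.
by rewrite nth_default// scale0r.
Qed.

Lemma polyactD Y p q m : polyact Y (p + q) m = polyact Y p m + polyact Y q m.
Proof.
have h1 := leq_maxl (size p) (size q); have h2 := leq_maxr (size p) (size q).
rewrite (polyact_widen Y m (size_polyD p q)) (polyact_widen Y m h1) (polyact_widen Y m h2).
by rewrite -big_split; apply: eq_bigr => i _; rewrite coefD scalerDl.
Qed.

Lemma polyactZ Y (a : R) p m : polyact Y (a *: p) m = a *: polyact Y p m.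
Proof.
rewrite (polyact_widen Y m (size_scale_leq a p)) scaler_sumr.
by apply: eq_bigr => i _; rewrite coefZ scalerA.
Qed.

Lemma polyactXn Y k m : polyact Y 'X^k m = Y (m + k)%N.
Proof.
rewrite /polyact size_polyXn big_ord_recr/= coefXn eqxx scale1r big1 ?add0r// => i _.
by rewrite coefXn ltn_eqF// scale0r.
Qed.

Definition stationary Y := forall m n, B (Y m.+1) (Y n.+1) = B (Y m) (Y n).

Lemma stationaryD Y k m n : stationary Y -> B (Y (k + m)%N) (Y (k + n)%N) = B (Y m) (Y n).
Proof. by move=> sY; elim: k => // k IH; rewrite !addSn sY. Qed.

Lemma polyact_stationary Y p q k m n : stationary Y ->
  B (polyact Y p (k + m)) (polyact Y q (k + n)) = B (polyact Y p m) (polyact Y q n).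
Proof.
move=> sY; rewrite /polyact !form_suml; apply: eq_bigr => i _.
rewrite !form_sumr; apply: eq_bigr => j _; rewrite !formZl !formZr -!addnA.
by rewrite stationaryD.
Qed.

(** At the vertex [t = - B x y / B y y] of the parabola the square norm drops by
    [B x y ^+ 2 / B y y], which minimality forces to be 0. *)
Lemma form_perp_of_min (x y : V) : (forall t, B x x <= B (x + t *: y) (x + t *: y)) ->
  B x y = 0.
Proof.
move=> h; have [/form_null_r //|yN0] := eqVneq (B y y) 0.
have yp : 0 < B y y by rewrite lt_def yN0 form_ge0.
have := h (- (B x y / B y y)); rewrite !(formDl, formDr, formZl, formZr) (formC B y x).
set a := B x y; set b := B y y in yp yN0 *.
have -> : B x x + - (a / b) * a + (- (a / b) * a + - (a / b) * (- (a / b) * b)) =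
   B x x - a ^+ 2 / b by field.
rewrite lerDl oppr_ge0 => h2; apply/eqP; rewrite -sqrf_eq0 eq_le sqr_ge0 andbT.
by move: h2; rewrite pmulr_lle0// invr_gt0.
Qed.

(* [eps m] is [Y m] minus its projection on the closed span of the [Y j], [j > m].
   The same polynomials [p l] serve for all [m], so [eps] is jointly stationary with [Y]. *)
Lemma innovation Y : complete_semi B -> stationary Y ->
  exists (p : nat -> {poly R}) (eps : nat -> V),
  [/\ forall l, (p l)`_0 = 1,
      forall m, cvg_semi B (fun l => polyact Y (p l) m) (eps m),
      forall c, (forall q : {poly R}, q`_0 = 1 -> c <= B (polyact Y q 0) (polyact Y q 0)) ->
        c <= B (eps 0) (eps 0)
    & forall m j, (m < j)%N -> B (eps m) (Y j) = 0].
Proof.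
move=> cB sY.
have sY0 q m : B (polyact Y q m) (polyact Y q m) = B (polyact Y q 0) (polyact Y q 0).
  by rewrite -{1 2}(addn0 m) polyact_stationary.
(* [inf A] is the squared distance of [Y 0] from the span of [Y 1, Y 2, ...]. *)
pose A := [set B (polyact Y q 0) (polyact Y q 0) | q in [set q : {poly R} | q`_0 = 1]].
have hA : has_inf A.
  split; first by exists (B (polyact Y 1 0) (polyact Y 1 0)), 1 => //=; rewrite coef1.
  by exists 0 => _ [q _ <-]; exact: form_ge0.
have Ale q m : q`_0 = 1 -> inf A <= B (polyact Y q m) (polyact Y q m).
  by move=> q0; rewrite sY0; apply: ge_inf; [case: hA | exists q].
have [p hp] : {p : nat -> {poly R} & forall l, (p l)`_0 = 1 /\
    forall m, B (polyact Y (p l) m) (polyact Y (p l) m) < inf A + l.+1%:R^-1}.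
  apply: (@choice _ _ (fun l (q : {poly R}) => q`_0 = 1 /\
    forall m, B (polyact Y q m) (polyact Y q m) < inf A + l.+1%:R^-1)) => l.
  have [_ [q q0 <-] h] := @inf_adherent _ A l.+1%:R^-1 ltac:(by rewrite invr_gt0) hA.
  by exists q; split=> // m; rewrite sY0.
have cp m : cauchy_semi B (fun l => polyact Y (p l) m).
  move=> e e0 /=; have [N hN] : exists N, forall k, (N <= k)%N -> (k.+1%:R^-1 : R) < e / 4.
    have e4 : 0 < e / 4 by lra.
    have := @near_infty_natSinv_lt R (PosNum e4).
    by case=> N _ h; exists N => k /h.
  exists N => k l Nk Nl.
  (* Parallelogram law: the midpoint of two near-minimizers also has constant coefficient 1, so its
     square norm is at least [inf A]. This bounds the square norm of the difference by
     [2 / (k + 1) + 2 / (l + 1)], whence the threshold [e / 4]. *)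
  have hkl : inf A <= B (polyact Y (2^-1 *: (p k + p l)) m) (polyact Y (2^-1 *: (p k + p l)) m).
    by apply: Ale; rewrite coefZ coefD !(hp _).1; field.
  move: hkl; rewrite polyactZ polyactD formZl formZr !(formDl, formDr).
  have := (hp k).2 m; have := (hp l).2 m.
  rewrite !(formNl, formNr, opprK) (formC _ (polyact Y (p l) m) (polyact Y (p k) m)).
  have := hN k Nk; have := hN l Nl; move: (k.+1%:R^-1) (l.+1%:R^-1).
  move: (B _ _) (B _ _) (B _ _) (inf A) => s t r u a b.
  lra.
have /choice [eps heps] : forall m, exists x, cvg_semi B (fun l => polyact Y (p l) m) x.
  by move=> m; exact: cB (cp m).
have ge_lim (c : R) x z : cvg_semi B x z -> (forall l, c <= B (x l) (x l)) -> c <= B z z.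
  by move=> xz h; apply: (cvgr_to_ge (cvg_form xz xz)); exact: nearW.
have epsA m : B (eps m) (eps m) = inf A.
  apply/eqP; rewrite eq_le; apply/andP; split; last first.
    by apply: (ge_lim _ _ _ (heps m)) => l; apply: Ale; exact: (hp l).1.
  have h : inf A + l.+1%:R^-1 @[l --> \oo] --> inf A + 0.
    by apply: cvgD; [exact: cvg_cst | exact: cvg_harmonic].
  rewrite addr0 in h; apply: (ler_cvg_to (cvg_form (heps m) (heps m)) h).
  by apply: nearW => l; apply/ltW; exact: (hp l).2.
exists p, eps; split => //.
- by move=> l; exact: (hp l).1.
- by move=> c hc; rewrite epsA; apply: lb_le_inf => [|_ [q q0 <-]]; [case: hA | exact: hc].
- move=> m j mj; apply: form_perp_of_min => t; rewrite epsA.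
  apply: (ge_lim _ (fun l => polyact Y (p l) m + t *: Y j)) => [|l].
    by apply: cvg_semiD => //; exact: cvg_semi_cst.
  (* As [j > m], the perturbation leaves the constant coefficient equal to 1, so the lower bound
     [inf A] still applies. *)
  have -> : polyact Y (p l) m + t *: Y j = polyact Y (p l + t *: 'X^(j - m)) m.
    by rewrite polyactD polyactZ polyactXn subnKC// ltnW.
  by apply: Ale; rewrite coefD coefZ coefXn (hp l).1 eq_sym subn_eq0 leqNgt mj mulr0 addr0.
Qed.

End Wold.

(** * Orthogonality and stationarity of the innovations *)

Section Innovation.
Context {R : realType} {V : lmodType R} (B : semi_inner V).
Variables (Y eps : nat -> V) (p : nat -> {poly R}).
Hypotheses (sY : stationary B Y) (p0 : forall l, (p l)`_0 = 1)
  (lim_eps : forall m, cvg_semi B (fun l => polyact Y (p l) m) (eps m))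
  (perp_eps : forall m j, (m < j)%N -> B (eps m) (Y j) = 0).

(** [eps m] differs from [Y m] by a limit of combinations of the [Y j], [j > m], and [z] is
    orthogonal to all of these. *)
Lemma form_innovation z m : (forall j, (m < j)%N -> B z (Y j) = 0) ->
  B z (eps m) = B z (Y m).
Proof.
move=> zY; have /= h := cvg_form (cvg_semi_cst B z) (lim_eps m).
apply/esym/(cvg_unique _ _ h) => //.
suff -> : (fun l => B z (polyact Y (p l) m)) = fun=> B z (Y m) by exact: cvg_cst.
apply/funext => l; rewrite (polyact_widen _ _ (leqnSn _)) big_ord_recl/= p0 scale1r addn0.
rewrite formDr form_sumr big1 ?addr0// => i _.
by rewrite formZr zY ?mulr0// -addSnnS leq_addr.
Qed.

Lemma innovation_perp m n : (m < n)%N -> B (eps m) (eps n) = 0.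
Proof.
move=> mn; rewrite form_innovation ?perp_eps// => j nj.
by rewrite perp_eps// (ltn_trans mn).
Qed.

Lemma innovationD k m n : B (eps (k + m)) (eps (k + n)) = B (eps m) (eps n).
Proof.
have /= h := cvg_form (lim_eps (k + m)) (lim_eps (k + n)).
have E l : B (polyact Y (p l) (k + m)) (polyact Y (p l) (k + n)) =
    B (polyact Y (p l) m) (polyact Y (p l) n) by rewrite polyact_stationary.
rewrite (funext E) in h.
by apply: (cvg_unique _ h (cvg_form (lim_eps m) (lim_eps n))).
Qed.

Lemma form_seq_innovationD k m n : B (Y (k + m)%N) (eps (k + n)) = B (Y m) (eps n).
Proof.
have /= h := cvg_form (cvg_semi_cst B (Y (k + m)%N)) (lim_eps (k + n)).
have YE i : Y i = polyact Y 1 i by rewrite -(expr0 'X) polyactXn addn0.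
have E l : B (Y (k + m)%N) (polyact Y (p l) (k + n)) = B (Y m) (polyact Y (p l) n).
  by rewrite !YE polyact_stationary.
rewrite (funext E) in h.
by apply: (cvg_unique _ h (cvg_form (cvg_semi_cst B (Y m)) (lim_eps n))).
Qed.

Lemma form_innovations m n : B (eps m) (eps n) = (m == n)%:R * B (eps 0) (eps 0).
Proof.
case: (ltngtP m n) => [mn|nm|->].
- by rewrite innovation_perp// mul0r.
- by rewrite formC innovation_perp// mul0r.
- by rewrite mul1r -{1 2}(addn0 n) innovationD.
Qed.

End Innovation.

(** * Nonpositive correlations keep [Y 0] away from its future *)

Section NonpositiveCorrelations.
Context {R : realType} {V : lmodType R} (B : semi_inner V).
Variable Y : nat -> V.
Hypotheses (sY : stationary B Y) (Yle0 : forall n, (0 < n)%N -> B (Y 0) (Y n) <= 0).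

Let C m := \sum_(n < m) B (Y 0) (Y n.+1).

Let sumC i : \sum_(j < i) B (Y i) (Y j) = C i.
Proof.
rewrite (reindex_inj rev_ord_inj)/= /C; apply: eq_bigr => j _.
rewrite formC -(stationaryD (i - j.+1) 0 j.+1 sY) addn0.
by rewrite subnK.
Qed.

Let sumC_row i r : \sum_(j < i + r.+1) B (Y i) (Y j) = C i + B (Y 0) (Y 0) + C r.
Proof.
rewrite big_split_ord/= sumC -addrA; congr (_ + _).
rewrite big_ord_recl/= -{1}(addn0 i) stationaryD//; congr (_ + _).
by apply: eq_bigr => j _; rewrite -{1}(addn0 i) stationaryD.
Qed.

Let C_le0 m n : (m <= n)%N -> C n <= C m.
Proof.
move=> /subnKC <-; rewrite /C big_split_ord/= gerDl.
by apply: sumr_le0 => i _; exact: Yle0.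
Qed.

Let sum_sqr M : B (\sum_(i < M) Y i) (\sum_(i < M) Y i) =
  M%:R * B (Y 0) (Y 0) + 2 * \sum_(m < M) C m.
Proof.
elim: M => [|M IH]; first by rewrite !big_ord0 form0l; ring.
rewrite big_ord_recr/= !(formDl, formDr) IH big_ord_recr/=.
rewrite (formC B (\sum_(i < M) Y i) (Y M)) !form_sumr sumC.
have := stationaryD M 0 0 sY; rewrite addn0 => ->; rewrite -natr1; ring.
Qed.

(* The norms of the ergodic sums are nonnegative, and their squares have slope
   [B (Y 0) (Y 0) + 2 * C N] at most in the number of summands. *)
Let C_ge N : 0 <= B (Y 0) (Y 0) + 2 * C N.
Proof.
have h k : 0 <= (N + k)%:R * B (Y 0) (Y 0) + 2 * (k%:R * C N).
  apply: le_trans (form_ge0 B (\sum_(i < N + k) Y i)) _.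
  (* Of the [N + k] partial sums, the first [N] are at most 0 and the others at most [C N]. *)
  rewrite sum_sqr lerD2l ler_pM2l// big_split_ord/=.
  have := C_le0 (leq0n _); rewrite {2}/C big_ord0 => C0.
  rewrite -[leRHS]add0r; apply: lerD; first by apply: sumr_le0 => i _; exact: C0.
  rewrite -[k in k%:R](card_ord k) -sum1_card natr_sum mulr_suml.
  by apply: ler_sum => i _; rewrite mul1r C_le0// leq_addr.
rewrite leNgt; apply/negP => c0.
set s := - (B (Y 0) (Y 0) + 2 * C N); have s0 : 0 < s by rewrite oppr_gt0.
(* This number of extra summands makes the linear loss [k%:R * s] exceed the constant
   [N%:R * B (Y 0) (Y 0)]. *)
have := h (Num.truncn (N%:R * B (Y 0) (Y 0) / s)).+1.
set k := _.+1; have kb : N%:R * B (Y 0) (Y 0) < k%:R * s.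
  by rewrite -ltr_pdivrMr// truncnS_gt.
rewrite natrD; move: kb; rewrite /s; nra.
Qed.

Lemma nonpos_correlations_dist (q : {poly R}) : q`_0 = 1 ->
  B (Y 0) (Y 0) / 2 <= B (polyact Y q 0) (polyact Y q 0).
Proof.
move=> q0; rewrite (polyact_widen Y 0 (leqnSn _)); set N := (size q).+1.
have -> : \sum_(i < N) q`_i *: Y (0 + i)%N = \sum_(i < N) q`_i *: Y i by [].
have -> : B (\sum_(i < N) q`_i *: Y i) (\sum_(i < N) q`_i *: Y i) =
    \sum_(i < N) q`_i ^+ 2 * (\sum_(j < N) B (Y i) (Y j)) +
    \sum_(i < N) \sum_(j < N) - 2^-1 * B (Y i) (Y j) * (q`_i - q`_j) ^+ 2.
  have sw : \sum_(i < N) \sum_(j < N) 2^-1 * (q`_j ^+ 2 * B (Y i) (Y j)) =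
       \sum_(i < N) \sum_(j < N) 2^-1 * (q`_i ^+ 2 * B (Y i) (Y j)).
    by rewrite exchange_big/=; apply: eq_bigr => i _; apply: eq_bigr => j _; rewrite formC.
  apply/eqP; rewrite -subr_eq0 -[X in _ == X](subrr (\sum_(i < N) \sum_(j < N)
    2^-1 * (q`_i ^+ 2 * B (Y i) (Y j)))).
  rewrite -[X in _ == X - _]sw form_suml -big_split/= -!sumrB; apply/eqP.
  apply: eq_bigr => i _.
  rewrite form_sumr mulr_sumr -big_split/= -!sumrB; apply: eq_bigr => j _.
  by rewrite formZl formZr; field.
rewrite -[leLHS]addr0; apply: lerD; last first.
  apply: sumr_ge0 => i _; apply: sumr_ge0 => j _.
  have [->|ij] := eqVneq i j; first by rewrite subrr expr0n mulr0.
  apply: mulr_ge0; last exact: sqr_ge0.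
  rewrite mulNr oppr_ge0 pmulr_rle0//.
  wlog lij : i j ij / (i < j)%N => [W|].
    have /orP[] : (i < j)%N || (j < i)%N by rewrite -neq_ltn.
    - exact: W.
    - by rewrite formC; apply: W; rewrite eq_sym.
  rewrite -(subnKC (ltnW lij)) -{1}(addn0 i) stationaryD// Yle0//.
  by rewrite subn_gt0.
have row (i : 'I_N) : \sum_(j < N) B (Y i) (Y j) = C i + B (Y 0) (Y 0) + C (N - i.+1).
  rewrite -sumC_row; have -> // : (i + (N - i.+1).+1)%N = N.
  by rewrite -subSn// subSS subnKC// ltnW.
(* By [C_ge] each [C] is at least [- B (Y 0) (Y 0) / 2]. Row 0 has only one nontrivial such sum, as
   [C 0 = 0]; the other rows have two, which the diagonal entry compensates. *)
rewrite big_ord_recl /= q0 expr1n mul1r -[leLHS]addr0; apply: lerD.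
  have := row ord0; rewrite /= => ->; have := C_ge (N - 1); rewrite {2}/C big_ord0; lra.
apply: sumr_ge0 => i _; apply: mulr_ge0; first exact: sqr_ge0.
have := row (lift ord0 i); rewrite /= => ->.
have := C_ge (lift ord0 i); have := C_ge (N - (lift ord0 i).+1); rewrite /=; lra.
Qed.

End NonpositiveCorrelations.

(** * Limits and their transport by isometries *)

Section SemiLimits.
Context {R : realType} {V : lmodType R} (B : semi_inner V).

(** Limits are determined only up to null vectors, so uniqueness is expressed through pairings. *)
Lemma cvg_semi_unique (u : nat -> V) (x y z : V) :
  cvg_semi B u x -> cvg_semi B u y -> B z x = B z y.
Proof.
move=> ux uy.
exact: (cvg_unique _ (cvg_form (cvg_semi_cst B z) ux) (cvg_form (cvg_semi_cst B z) uy)).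
Qed.

Lemma cvg_semi_cauchy (u : nat -> V) (x : V) : cvg_semi B u x -> cauchy_semi B u.
Proof.
move=> ux e e0; pose c := Num.sqrt e / 2; have se : 0 < Num.sqrt e by rewrite sqrtr_gt0.
have c0 : 0 < c by rewrite /c; lra.
have [N _ hN] := (@cvgr0Pnorm_lt _ _ _ _ _ _).1 ux c c0.
exists N => m n Nm Nn; rewrite -seminorm_sqr -(sqr_sqrtr (ltW e0)).
rewrite ltr_pXn2r ?nnegrE ?seminorm_ge0 ?sqrtr_ge0//.
have -> : u m - u n = (u m - x) + - (u n - x) by rewrite opprB addrA subrK.
apply: le_lt_trans (seminormD _ _ _) _; rewrite seminormN.
have := hN m Nm; have := hN n Nn; rewrite !ger0_norm ?seminorm_ge0// /c.
lra.
Qed.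

Lemma cvg_semi_sqr (u : nat -> V) (x : V) :
  (forall e, 0 < e -> exists N, forall n, (N <= n)%N -> B (u n - x) (u n - x) < e) ->
  cvg_semi B u x.
Proof.
move=> h; apply/cvgr0Pnorm_lt => e e0; have [N hN] := h (e ^+ 2) (exprn_gt0 2 e0).
exists N => // n /= Nn; rewrite ger0_norm ?seminorm_ge0//.
by rewrite -(ltr_pXn2r (ltn0Sn 1)) ?nnegrE ?seminorm_ge0 ?(ltW e0)// seminorm_sqr hN.
Qed.

(** Equal Gram matrices give differences of equal length, so each [u i] is Cauchy because [v i]
    converges, and pairings of limits are limits of equal pairings. *)
Lemma isometric_limits (u v : nat -> nat -> V) (Y : nat -> V) : complete_semi B ->
  (forall i j k l, B (u i k) (u j l) = B (v i k) (v j l)) ->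
  (forall i, cvg_semi B (v i) (Y i)) ->
  exists F : nat -> V, (forall i, cvg_semi B (u i) (F i)) /\
    forall i j, B (F i) (F j) = B (Y i) (Y j).
Proof.
move=> cB uv vY.
have cu i : cauchy_semi B (u i).
  move=> e e0; have [N hN] := cvg_semi_cauchy (vY i) e0; exists N => m n Nm Nn.
  by have := hN m n Nm Nn; rewrite !(formBl, formBr) !uv.
have /choice [F hF] : forall i, exists x, cvg_semi B (u i) x by move=> i; exact: cB (cu i).
exists F; split => // i j; have /= h := cvg_form (hF i) (hF j).
rewrite (funext (fun k => uv i j k k)) in h.
exact: (cvg_unique _ h (cvg_form (vY i) (vY j))).
Qed.

End SemiLimits.

(** * Expansion of a stationary sequence in its innovations *)

Section Expansion.
Context {R : realType} {V : lmodType R} (B : semi_inner V).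
Variables (Y eps : nat -> V) (p : nat -> {poly R}).
Hypotheses (sY : stationary B Y) (p0 : forall l, (p l)`_0 = 1)
  (lim_eps : forall m, cvg_semi B (fun l => polyact Y (p l) m) (eps m))
  (perp_eps : forall m j, (m < j)%N -> B (eps m) (Y j) = 0).

Let s := B (eps 0) (eps 0).

(** The Fourier coefficient of [Y 0] along [eps k]. If [s = 0], division yields 0, which is
    consistent: [eps k] is then null and pairs to 0 with everything. *)
Definition innovation_coef k := B (Y 0) (eps k) / s.
Let d := innovation_coef.

Let r n m := Y n - \sum_(k < m) d k *: eps (n + k)%N.

Let eps_eps := form_innovations sY p0 lim_eps perp_eps.

Let divsK (z : V) k : B z (eps k) / s * s = B z (eps k).
Proof.
have [s0|?] := eqVneq s 0; last by rewrite divfK.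
by rewrite s0 mulr0 form_null_r// eps_eps -/s s0 mulr0.
Qed.

Let form_sum_eps m n (z : V) : B (\sum_(k < m) d k *: eps (n + k)%N) z =
  \sum_(k < m) d k * B (eps (n + k)%N) z.
Proof. by rewrite form_suml; apply: eq_bigr => k _; rewrite formZl. Qed.

Let r_eps m k : (k < m)%N -> B (r 0 m) (eps k) = 0.
Proof.
move=> km; rewrite formBl form_sum_eps (bigD1 (Ordinal km))//= big1 ?addr0.
  by rewrite add0n eps_eps eqxx mul1r divsK subrr.
move=> i /eqP ik; rewrite add0n eps_eps; case: eqP => [e|_]; last by rewrite mul0r mulr0.
by case: ik; apply/val_inj.
Qed.

(** The remainder [r 0 m] should lie in the closed span of the [Y j], [j >= m]; this is its dual
    form. In the induction, removing from [z] its component along [eps m] makes it orthogonal to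
    [Y m] as well. *)
Let r_perp m : forall z, (forall j, (m <= j)%N -> B z (Y j) = 0) -> B (r 0 m) z = 0.
Proof.
elim: m => [|m IH] z hz; first by rewrite /r big_ord0 subr0 formC hz.
set t := B z (eps m) / s; pose z' := z - t *: eps m.
have z'eps : B z' (eps m) = 0.
  by rewrite formBl formZl eps_eps eqxx mul1r divsK subrr.
have z'Y j : (m <= j)%N -> B z' (Y j) = 0.
  rewrite leq_eqVlt => /predU1P[<-|mj]; last first.
    by rewrite formBl formZl hz// perp_eps// mulr0 subr0.
  rewrite -(form_innovation p0 lim_eps)// => j' mj'.
  by rewrite formBl formZl hz// perp_eps// mulr0 subr0.
have -> : z = z' + t *: eps m by rewrite subrK.
rewrite formDr formZr r_eps// mulr0 addr0.
rewrite /r big_ord_recr/= opprD addrA formBl -/(r 0 m) IH// formZl.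
by rewrite add0n (formC _ (eps m)) z'eps mulr0 subrr.
Qed.

Let r_stationary n m : B (r n m) (r n m) = B (r 0 m) (r 0 m).
Proof.
have h i k : B (Y n) (eps (n + i)) = B (Y 0) (eps (0 + i)) /\
   B (eps (n + i)%N) (eps (n + k)%N) = B (eps (0 + i)%N) (eps (0 + k)%N).
  rewrite -{1}(addn0 n) (form_seq_innovationD sY lim_eps) (innovationD sY lim_eps).
  by rewrite !add0n.
have YS : B (Y n) (\sum_(k < m) d k *: eps (n + k)%N) =
    B (Y 0) (\sum_(k < m) d k *: eps (0 + k)%N).
  by rewrite !form_sumr; apply: eq_bigr => k _; rewrite !formZr (h k 0).1.
rewrite !(formBl, formBr) (formC _ _ (Y n)) (formC _ _ (Y 0)) YS -{1 2}(addn0 n) stationaryD//.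
congr (_ - _ - (_ - _)); rewrite !form_sum_eps; apply: eq_bigr => k _.
by rewrite !form_sumr; congr (_ * _); apply: eq_bigr => l _; rewrite !formZr (h k l).2.
Qed.

(** The hypothesis excludes a component of [Y 0] in the remote future. The remainder [r] is
    orthogonal to [w] and to the innovations already used, so [B r r = B (Y 0 - w) r], and
    Cauchy-Schwarz bounds [B r r] by the square norm of [Y 0 - w]. *)
Lemma innovation_expansion :
  (forall e, 0 < e -> exists m w, (forall j, (m <= j)%N -> B w (Y j) = 0) /\
     B (Y 0 - w) (Y 0 - w) < e) ->
  forall n, cvg_semi B (fun m => \sum_(k < m) innovation_coef k *: eps (n + k)%N) (Y n).
Proof.
move=> room n; apply: cvg_semi_sqr => e e0; have [m [w [wY we]]] := room e e0.
exists m => m' mm'; rewrite -opprB formNl formNr opprK -/(r n m') r_stationary.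
have rw : B (r 0 m') w = 0 by apply: r_perp => j m'j; rewrite wY// (leq_trans mm').
have rY : B (r 0 m') (r 0 m') = B (Y 0 - w) (r 0 m').
  rewrite formBl (formC _ w) rw subr0 {1}/r formBl form_sum_eps big1 ?subr0// => k _.
  by rewrite add0n formC r_eps ?mulr0 ?ltn_ord.
apply: le_lt_trans we.
have [->|rN0] := eqVneq (B (r 0 m') (r 0 m')) 0; first exact: form_ge0.
have rp : 0 < B (r 0 m') (r 0 m') by rewrite lt_def rN0 form_ge0.
rewrite -(ler_pM2r rp); apply: le_trans (form_sqr_le _ _ _).
by rewrite -rY expr2.
Qed.

End Expansion.

(** * Stationary sequences built from orthogonal finite blocks *)

(** The coefficients of [q] are read as a finitely supported sequence: [nth] returns 0 beyond the
    size, so [i + n] may run out of range. *)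
Definition autocorr (R : realType) (q : {poly R}) (n : nat) : R :=
  \sum_(i < size q) q`_i * q`_(i + n)%N.

Section Blocks.
Context {R : realType} {V : lmodType R} (B : semi_inner V).
Variables (e : nat -> nat -> V) (y : nat -> {poly R}).
Hypotheses (cB : complete_semi B)
  (orth_e : forall k i l j, B (e k i) (e l j) = ((k == l) && (i == j))%:R)
  (cvg_y : cvgn (fun N => \sum_(k < N) autocorr (y k) 0)).

Let blk k j := polyact (e k) (y k) j.
Let Z N j := \sum_(k < N) blk k j.
Let A N := \sum_(k < N) autocorr (y k) 0.

Let e_stationary k : stationary B (e k).
Proof. by move=> m n; rewrite !orth_e eqxx eqSS. Qed.

Let blk_orth k l i j : k != l -> B (blk k i) (blk l j) = 0.
Proof.
move=> /negbTE kl; rewrite form_suml big1// => a _; rewrite form_sumr big1// => b _.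
by rewrite formZl formZr orth_e kl !mulr0.
Qed.

Let blkE k i n : B (blk k i) (blk k (i + n)) = autocorr (y k) n.
Proof.
rewrite -{1}(addn0 i) polyact_stationary// /polyact form_sumr; apply: eq_bigr => b _.
rewrite formZr form_suml; congr (_ * _).
under eq_bigr => a _ do rewrite formZl orth_e eqxx add0n/=.
rewrite [(b + n)%N]addnC; case: (ltnP (n + b) (size (y k))) => h.
  rewrite (bigD1 (Ordinal h))//= eqxx mulr1 big1 ?addr0// => a /eqP an.
  by case: eqP => [ab|_]; rewrite ?mulr0//; case: an; apply/val_inj.
rewrite nth_default// big1// => a _; rewrite ltn_eqF ?mulr0//.
exact: leq_trans (ltn_ord a) h.
Qed.

Let ZE M N i j : (M <= N)%N -> B (Z M i) (Z N j) = \sum_(k < M) B (blk k i) (blk k j).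
Proof.
move=> MN; rewrite form_suml; apply: eq_bigr => k _; rewrite form_sumr.
rewrite (bigD1 (widen_ord MN k))//= big1 ?addr0// => l /eqP lk.
by apply: blk_orth; apply/eqP => kl; apply: lk; apply/val_inj.
Qed.

Let ZA M N j : (M <= N)%N -> B (Z M j) (Z N j) = A M.
Proof. by move=> MN; rewrite ZE//; apply: eq_bigr => k _; rewrite -{2}(addn0 j) blkE. Qed.

Let Z_cauchy j : cauchy_semi B (Z ^~ j).
Proof.
move=> d d0; have d2 : 0 < d / 2 by lra.
have [N _ hN] := (@cvgrPdist_lt _ _ _ _ _ _ _).1 cvg_y _ d2.
exists N => m n Nm Nn.
wlog mn : m n Nm Nn / (m <= n)%N => [W|].
  have /orP[] := leq_total m n; first exact: W.
  by rewrite -opprB formNl formNr opprK; exact: W.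
(* Orthogonality of the blocks gives the square norm [A n - A m]. *)
rewrite !(formBl, formBr) (formC B (Z n j) (Z m j)) !ZA//.
by move: (hN _ Nm) (hN _ Nn); rewrite -/(A m) -/(A n) !ltr_norml; lra.
Qed.

(** [Y j] is the limit of [Z N j], the sum over [k < N] of the blocks [y k] started at index [j] of
    the [k]-th copy; its correlations add up over the blocks. *)
Lemma stationary_of_blocks : exists Y : nat -> V,
  [/\ stationary B Y,
      forall n (a : R), \sum_(k < N) autocorr (y k) n @[N --> \oo] --> a ->
        B (Y 0) (Y n) = a
    & forall d, 0 < d -> exists m w, (forall j, (m <= j)%N -> B w (Y j) = 0) /\
        B (Y 0 - w) (Y 0 - w) < d].
Proof.
have /choice [Y hY] : forall j, exists x, cvg_semi B (Z ^~ j) x.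
  by move=> j; exact: cB (Z_cauchy j).
have YE i j : \sum_(k < N) B (blk k i) (blk k j) @[N --> \oo] --> B (Y i) (Y j).
  have /= h := cvg_form (hY i) (hY j).
  by rewrite (funext (fun N => ZE i j (leqnn N))) in h.
exists Y; split.
- move=> m n; have h := YE m.+1 n.+1; apply/esym.
  rewrite [X in X @ _](_ : _ = fun N => \sum_(k < N) B (blk k m) (blk k n)) in h.
    exact: (cvg_unique _ (YE m n) h).
  apply/funext => N; apply: eq_bigr => k _.
  by rewrite -add1n -(add1n n) polyact_stationary.
- move=> n a ha; have h := YE 0%N n.
  rewrite [X in X @ _](_ : _ = fun N => \sum_(k < N) autocorr (y k) n) in h.
    exact: (cvg_unique _ h ha).
  by apply/funext => N; apply: eq_bigr => k _; rewrite -[n]add0n blkE.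
- move=> d d0.
  have [N hN] : exists N, B (Y 0%N - Z N 0) (Y 0%N - Z N 0) < d.
    have h : B (Y 0%N - Z N 0) (Y 0%N - Z N 0) @[N --> \oo] --> B (Y 0%N - Y 0%N) (Y 0%N - Y 0%N).
      have ZY : cvg_semi B (fun N => Y 0%N - Z N 0) (Y 0%N - Y 0%N).
        apply: cvg_semiD; first exact: cvg_semi_cst.
        by have := cvg_semiZ (-1) (hY 0%N); rewrite scaleN1r (funext (fun N => scaleN1r _)).
      exact: cvg_form.
    rewrite subrr form0l in h.
    have [N _ hN] := (@cvgr0Pnorm_lt _ _ _ _ _ _).1 h _ d0.
    by exists N; apply: le_lt_trans (hN N (leqnn N)); exact: ler_norm.
  (* [Z N 0] involves only [e k i] with [k < N] and [i] below the largest block size, while [Y j] is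
     a limit of vectors supported on indices from [j] on. *)
  exists (\max_(k < N) size (y k)), (Z N 0); split => // j hj.
  have h := cvg_form (cvg_semi_cst B (Z N 0)) (hY j).
  apply: (cvg_unique _ h) => //.
  apply: cvg_near_cst; exists N => // M /= NM; rewrite ZE// big1// => k _.
  rewrite -{1}[j]add0n blkE /autocorr big1// => i _.
  rewrite [X in _ * X]nth_default ?mulr0// (leq_trans _ (leq_addl _ _))//.
  by apply: leq_trans hj; exact: (leq_bigmax_cond (F := fun k : 'I_N => size (y k))).
Qed.

End Blocks.

(** * Realization of correlations along the orbit of an isometry *)

Section Realization.
Context {R : realType} {V : lmodType R} (B : semi_inner V).
Variables (U : V -> V) (o f : V).
Hypotheses (cB : complete_semi B) (linU : linear U)
  (isoU : forall x y, B (U x) (U y) = B x y) (Uo : forall x, B (U x) o = B x o).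

Let linUn n : linear (iter n U).
Proof. by elim: n => [//|n IH] a x y; rewrite !iterS IH linU. Qed.

Let isoUn n x y : B (iter n U x) (iter n U y) = B x y.
Proof. by elim: n => [//|n IH]; rewrite !iterS isoU. Qed.

Let iterB n x y : iter n U (x - y) = iter n U x - iter n U y.
Proof. by rewrite addrC -scaleN1r linUn scaleN1r addrC. Qed.

Let iter0 n : iter n U 0 = 0.
Proof. by rewrite -[X in iter n U X](subrr 0) iterB subrr. Qed.

Let iter_sum n m (a : nat -> R) (x : nat -> V) :
  iter n U (\sum_(k < m) a k *: x k) = \sum_(k < m) a k *: iter n U (x k).
Proof.
elim: m => [|m IH]; first by rewrite !big_ord0 iter0.
by rewrite !big_ord_recr/= addrC linUn IH addrC.
Qed.

Let cvg_iter n u x : cvg_semi B u x -> cvg_semi B (fun k => iter n U (u k)) (iter n U x).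
Proof.
rewrite /cvg_semi => ux; rewrite (_ : (fun k => _) = fun k => seminorm B (u k - x))//.
by apply/funext => k; rewrite -iterB /seminorm isoUn.
Qed.

(** In the application [U] is the Koopman operator and [o] the constant function 1, so orthogonality
    to [o] means mean zero. *)
Lemma correlation_realization (y : nat -> {poly R}) (a : nat -> R) :
  B f o = 0 -> 0 < B f f -> (forall n, (0 < n)%N -> B f (iter n U f) <= 0) ->
  cvgn (fun N => \sum_(k < N) autocorr (y k) 0) ->
  (forall n, (0 < n)%N -> \sum_(k < N) autocorr (y k) n @[N --> \oo] --> a n) ->
  exists F, B F o = 0 /\ forall n, (0 < n)%N -> B F (iter n U F) = a n.
Proof.
move=> fo f0 fU cvg_y ya.
pose Y1 j := iter j U f.
have sY1 : stationary B Y1 by move=> m n; rewrite /Y1 !iterS isoU.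
have [p [g [p0 lim_g g_ge perp_g]]] := innovation cB sY1.
have g0 : 0 < B (g 0) (g 0).
  have f2 : 0 < B f f / 2 by lra.
  by apply: lt_le_trans f2 _; apply: g_ge => q; exact: nonpos_correlations_dist.
pose c := (Num.sqrt (B (g 0) (g 0)))^-1; pose h k := c *: g k.
have hh i j : B (h i) (h j) = (i == j)%:R.
  rewrite formZl formZr (form_innovations sY1 p0 lim_g perp_g) mulrA mulrCA -expr2.
  by rewrite exprVn sqr_sqrtr ?(ltW g0)// mulVf ?mulr1// gt_eqF.
have ho k : B (h k) o = 0.
  rewrite formZl; have lim := cvg_form (lim_g k) (cvg_semi_cst B o).
  suff -> : B (g k) o = 0 by rewrite mulr0.
  apply: (cvg_unique _ lim) => //.
  suff -> : (fun l => B (polyact Y1 (p l) k) o) = fun=> 0 by exact: cvg_cst.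
  apply/funext => l; rewrite form_suml big1// => i _; rewrite formZl.
  suff -> : B (Y1 (k + i)%N) o = 0 by rewrite mulr0.
  by rewrite /Y1; elim: (k + i)%N => [//|j IH]; rewrite iterS Uo.
(* [iter n U (h k)] and [h (n + k)] are limits of the same sequence up to the factor [c], hence
   equal up to a null vector; pairing with [z] hides the difference. *)
have hU n k z : B z (iter n U (h k)) = B z (h (n + k)%N).
  have -> : iter n U (h k) = c *: iter n U (g k).
    by rewrite -[LHS](congr1 _ (addr0 _)) /h linUn iter0 addr0.
  rewrite !formZr; congr (_ * _).
  apply: (cvg_semi_unique z (cvg_iter n (lim_g k))).
  rewrite (_ : (fun l => _) = fun l => polyact Y1 (p l) (n + k)); first exact: lim_g.
  apply/funext => l; rewrite /polyact.
  rewrite (iter_sum n (size (p l)) (nth 0 (p l)) (fun i => Y1 (k + i)%N)).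
  by apply: eq_bigr => i _; rewrite /Y1 -addnA -iterD.
(* An injection of pairs into [nat] splits the orthonormal sequence into orthonormal copies. It does
   not respect [U], so [Y] below is stationary but need not be an orbit of [U]. *)
clearbody h; pose e (k i : nat) := h (pickle (k, i)).
have orth_e k i l j : B (e k i) (e l j) = ((k == l) && (i == j))%:R.
  by rewrite hh (inj_eq (pcan_inj pickleK)) xpair_eqE.
have [Y [sY Ya room]] := stationary_of_blocks cB orth_e cvg_y.
have [p2 [eps [p20 lim_eps _ perp_eps]]] := innovation cB sY.
have exp := innovation_expansion sY p20 lim_eps perp_eps room.
pose s := B (eps 0) (eps 0).
pose d := innovation_coef B Y eps.
(* Replacing [eps] by [Num.sqrt s] times [h] keeps the Gram matrix and turns the index shift into
   the action of [U]. *)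
pose u n m := \sum_(k < m) (d k * Num.sqrt s) *: h (n + k)%N.
have [F [uF FY]] : exists F : nat -> V, (forall n, cvg_semi B (u n) (F n)) /\
    forall i j, B (F i) (F j) = B (Y i) (Y j).
  apply: (isometric_limits cB _ exp) => i j k l; rewrite /u.
  rewrite !form_suml; apply: eq_bigr => b _; rewrite !form_sumr; apply: eq_bigr => b' _.
  rewrite !formZl !formZr hh (form_innovations sY p20 lim_eps perp_eps) -/s -/d.
  have := sqr_sqrtr (form_ge0 B (eps 0)); rewrite -/s; move: (Num.sqrt s) => t <-.
  ring.
exists (F 0%N); split.
  apply: (cvg_unique _ (cvg_form (uF 0%N) (cvg_semi_cst B o))) => //.
  rewrite (_ : (fun m => _) = fun=> 0); first exact: cvg_cst.
  by apply/funext => m; rewrite form_suml big1// => k _; rewrite formZl ho mulr0.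
move=> n n0; rewrite -(Ya n (a n) (ya n n0)) -FY.
apply: (cvg_unique _ (cvg_form (uF 0%N) (cvg_iter n (uF 0%N)))) => //.
rewrite (_ : (fun m => _) = fun m => B (u 0%N m) (u n m)); first exact: cvg_form.
apply/funext => m; rewrite /u.
rewrite (iter_sum n m (fun k => d k * Num.sqrt s) (fun k => h (0 + k)%N)) !form_sumr.
by apply: eq_bigr => k _; rewrite !formZr hU.
Qed.

End Realization.

(** * Sequences as sums of autocorrelations *)

Section Sequences.
Context {R : realType}.
Implicit Types (q : {poly R}) (a : nat -> R).

Lemma autocorr_widen q n N : (size q <= N)%N ->
  autocorr q n = \sum_(i < N) q`_i * q`_(i + n)%N.
Proof.
move=> qN; rewrite /autocorr (big_ord_widen N (fun i => q`_i * q`_(i + n)))//.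
rewrite big_mkcond/=; apply: eq_bigr => i _; case: ltnP => // h.
by rewrite nth_default// mul0r.
Qed.

Lemma autocorr0 n : autocorr (0 : {poly R}) n = 0.
Proof. by rewrite /autocorr size_poly0 big_ord0. Qed.

Lemma autocorr_two_points (c s : R) k n : (0 < k)%N ->
  autocorr (c *: (1 + s *: 'X^k)) n =
  c ^+ 2 * ((n == 0)%:R * (1 + s ^+ 2) + (n == k)%:R * s).
Proof.
move=> k0; have sz : (size (c *: (1 + s *: 'X^k) : {poly R})%R <= k.+1)%N.
  apply: leq_trans (size_scale_leq _ _) _; apply: leq_trans (size_polyD _ _) _.
  rewrite geq_max size_poly1 ltn0Sn/=; apply: leq_trans (size_scale_leq _ _) _.
  by rewrite size_polyXn.
rewrite (autocorr_widen _ sz).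
have qE i : (c *: (1 + s *: 'X^k) : {poly R})`_i = c * ((i == 0)%:R + s * (i == k)%:R).
  by rewrite coefZ coefD coefZ coefXn coef1.
case: k k0 {sz} qE => // k _ qE; rewrite big_ord_recl big_ord_recr/=.
rewrite big1 => [|i _]; last first.
  by rewrite /= qE /bump/= add1n/= eqSS ltn_eqF// mulr0n mulr0 addr0 mulr0 mul0r.
rewrite !qE /bump/= !add1n !add0n eqxx/= -[X in (_ + n == X)%N]addn0 eqn_add2l.
by case: (n == 0)%N; case: (n == k.+1)%N => /=; rewrite ?mulr1n ?mulr0n; ring.
Qed.

(** An interval of [k] points contains [k - n] pairs at distance [n]; truncated subtraction makes
    this the triangle function. *)
Lemma autocorr_interval (c : R) k n : autocorr (c *: \poly_(i < k) 1) n = c ^+ 2 * (k - n)%:R.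
Proof.
have sz : (size (c *: \poly_(i < k) 1 : {poly R})%R <= k)%N.
  by apply: leq_trans (size_scale_leq _ _) _; exact: size_poly.
rewrite (autocorr_widen _ sz).
have qE i : (c *: \poly_(i < k) 1 : {poly R})`_i = c * (i < k)%N%:R.
  by rewrite coefZ coef_poly; case: ltnP.
transitivity (\sum_(i < k) (i < k - n)%N%:R * c ^+ 2).
  apply: eq_bigr => i _; rewrite !qE ltn_ord ltn_subRL [(n + i)%N]addnC mulr1n; ring.
rewrite -mulr_suml mulrC; congr (_ * _); rewrite -natr_sum; congr (_%:R).
have h m : (\sum_(i < m) 1 = m)%N by rewrite sum1_card card_ord.
rewrite -[RHS]h (big_ord_widen k (fun=> 1%N) (leq_subr n k)) [RHS]big_mkcond.
by apply: eq_bigr => i _; case: (_ < _)%N.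
Qed.

(** The block on the points 0 and [k], scaled by the root of [|a k|] and signed by [a k],
    contributes [a k] at lag [k], at most [2 |a k|] at lag 0, and nothing at other lags. *)
Lemma summable_blocks a : absolutely_summable a -> exists y : nat -> {poly R},
  cvgn (fun N => \sum_(k < N) autocorr (y k) 0) /\
  forall n, (0 < n)%N -> \sum_(k < N) autocorr (y k) n @[N --> \oo] --> a n.
Proof.
move=> sa; pose y k : {poly R} :=
  if k == 0%N then 0 else Num.sqrt `|a k| *: (1 + Num.sg (a k) *: 'X^k).
have yE k n : autocorr (y k) n = if k == 0%N then 0 else
    `|a k| * ((n == 0%N)%:R * (1 + Num.sg (a k) ^+ 2) + (n == k)%:R * Num.sg (a k)).
  rewrite /y; case: (posnP k) => [_|k0]; first exact: autocorr0.
  by rewrite autocorr_two_points// sqr_sqrtr.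
exists y; split; last first.
  move=> n n0; apply: cvg_near_cst; exists n.+1 => // N /= nN.
  rewrite (bigD1 (Ordinal nN))//= big1 => [|k /eqP kn]; rewrite yE.
    by rewrite !(gtn_eqF n0) eqxx mulr0n mul0r add0r mulr1n mul1r addr0 mulrC mulr_sg_norm.
  case: eqP => // _; rewrite (gtn_eqF n0) mulr0n mul0r add0r.
  case: eqP => [nk|_]; last by rewrite mulr0n mul0r mulr0.
  by case: kn; apply/val_inj.
have y0 k : 0 <= autocorr (y k) 0.
  by apply: sumr_ge0 => i _; rewrite addn0 -expr2 sqr_ge0.
apply: nondecreasing_is_cvgn.
  by apply/nondecreasing_seqP => N; rewrite big_ord_recr lerDl.
have fin : (\sum_(0 <= k <oo | (1 <= k)%N) `|(a k)%:E| < +oo)%E.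
  by rewrite nneseries_esum//; exact: sa.
exists (2 * fine (\sum_(0 <= k <oo | (1 <= k)%N) `|(a k)%:E|)%E) => _ [N _ <-].
apply: (@le_trans _ _ (\sum_(k < N | (1 <= k)%N) 2 * `|a k|)).
  rewrite [leRHS]big_mkcond; apply: ler_sum => k _; rewrite yE/=.
  case: (posnP k) => // k0; rewrite mulr1n mul1r (ltn_eqF k0) mulr0n mul0r addr0 sqr_sg mulrC.
  by apply: ler_wpM2r => //; case: (_ != _); rewrite ?mulr0n ?mulr1n; lra.
rewrite -mulr_sumr ler_pM2l// -lee_fin fineK; last first.
  by rewrite ge0_fin_numE//; apply: nneseries_ge0.
rewrite -sumEFin -(big_mkord (fun k => (1 <= k)%N) (fun k => (`|a k|)%:E)).
by apply: (@nneseries_lim_ge _ (fun k => `|(a k)%:E|%E) (fun k => (1 <= k)%N)).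
Qed.

(** Summing by parts twice writes [a n] as the sum of [D k] times [k - n] over [k > n], where [D] is
    the second difference: a positive mixture of triangle functions. *)
Lemma convex_blocks a : decreases_convexly_to_0 a -> exists y : nat -> {poly R},
  cvgn (fun N => \sum_(k < N) autocorr (y k) 0) /\
  forall n, (0 < n)%N -> \sum_(k < N) autocorr (y k) n @[N --> \oo] --> a n.
Proof.
move=> [a0 cvx]; pose D k := a k.-1 + a k.+1 - 2 * a k.
(* [D k] is known to be nonnegative only from [k = 2] on; for [k < 2] the triangle function vanishes
   at all lags [n >= 1]. *)
pose y k : {poly R} := if (k < 2)%N then 0 else Num.sqrt (D k) *: \poly_(i < k) 1.
have yE k n : autocorr (y k) n = if (k < 2)%N then 0 else D k * (k - n)%:R.
  rewrite /y; case: ltnP => [_|k2]; first exact: autocorr0.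
  by rewrite autocorr_interval sqr_sqrtr//; exact: cvx.
pose dl k := a k - a k.+1.
have dlS k : (1 <= k)%N -> dl k.+1 <= dl k.
  by move=> k1; have := cvx k.+1 k1; rewrite /dl/=; lra.
have dl_le m n : (1 <= m)%N -> (m <= n)%N -> dl n <= dl m.
  move=> m1 /subnKC <-; elim: (n - m)%N => [|j IH]; first by rewrite addn0.
  by rewrite addnS; apply: le_trans (dlS _ _) IH; rewrite (leq_trans m1)// leq_addr.
have dl0 : dl k @[k --> \oo] --> (0 : R).
  rewrite -[0](subrr 0); apply: cvgB => //.
  by have := a0; rewrite -(cvg_shiftS a).
have dl_ge0 k : (1 <= k)%N -> 0 <= dl k.
  by move=> k1; apply: (cvgr_to_le dl0); exists k => // m /= km; exact: dl_le.
have a_ge0 k : (1 <= k)%N -> 0 <= a k.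
  move=> k1; apply: (cvgr_to_le a0); exists k => // m /= /subnKC <-.
  elim: (m - k)%N => [|j IH]; first by rewrite addn0.
  apply: le_trans IH; rewrite addnS -subr_ge0; apply: dl_ge0.
  by rewrite (leq_trans k1)// leq_addr.
have sumE n m : (1 <= n)%N -> \sum_(k < (n + m).+1) autocorr (y k) n =
    a n - a (n + m)%N - m%:R * dl (n + m)%N.
  move=> n1; elim: m => [|m IH].
    rewrite addn0 subrr mul0r subrr big1// => k _; rewrite yE; case: ifP => // _.
    by have /eqP -> : (k - n == 0)%N; [rewrite subn_eq0 -ltnS | rewrite mulr0].
  rewrite addnS big_ord_recr/= IH yE ifF; last first.
    by rewrite ltnS leqNgt ltnS (leq_trans n1)// leq_addr.
  rewrite -addnS addKn /D /dl addnS/= -natr1; ring.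
exists y; split; last first.
  move=> n n1.
  (* The differences [dl] are nonincreasing, so the upper half of the telescoping sum gives [(m - h)
     * dl (n + m) <= a (n + h) - a (n + m)] with [h = m./2]. Both values of [a] are below [e / 4] in
     size, and [m <= 2 * (m - h)]. *)
  have mdl : m%:R * dl (n + m)%N @[m --> \oo] --> (0 : R).
    apply/cvgr0Pnorm_lt => e e0; have e4 : 0 < e / 4 by lra.
    have [K _ hK] := (@cvgr0Pnorm_lt _ _ _ _ _ _).1 a0 _ e4.
    exists (K.*2) => // m /= Km; rewrite ger0_norm; last first.
      by apply: mulr_ge0 => //; apply: dl_ge0; rewrite (leq_trans n1)// leq_addr.
    pose h := m./2.
    have tel j : (h + j <= m)%N -> j%:R * dl (n + m)%N <= a (n + h)%N - a (n + h + j)%N.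
      elim: j => [|j IH] hj; first by rewrite mul0r addn0 subrr.
      have := IH (leq_trans (leq_add (leqnn _) (leqnSn _)) hj).
      have : dl (n + m)%N <= dl (n + h + j)%N.
        apply: dl_le; first by rewrite (leq_trans n1)// -addnA leq_addr.
        by rewrite -addnA leq_add2l (leq_trans _ hj)// addnS.
      rewrite /dl -natr1 mulrDl mul1r [(n + h + j.+1)%N]addnS; lra.
    have hm : (h <= m)%N by rewrite /h -divn2 leq_div.
    have := tel (m - h)%N; rewrite subnKC// leqnn => /(_ isT).
    rewrite -addnA subnKC//.
    have Kh : (K <= h)%N by rewrite /h -(doubleK K) half_leq.
    have := hK (n + h)%N (leq_trans Kh (leq_addl _ _)).
    have := hK (n + m)%N (leq_trans (leq_trans Kh hm) (leq_addl _ _)).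
    rewrite !ltr_norml => /andP[u1 u2] /andP[u3 u4] u5.
    have mh : (m <= (m - h).*2)%N.
      by rewrite doubleB leq_subRL ?leq_double// -(addnn m) leq_add2r -geq_half_double.
    have : m%:R <= 2 * (m - h)%:R :> R by rewrite -natrM mul2n ler_nat.
    have := dl_ge0 (n + m)%N (leq_trans n1 (leq_addr _ _)).
    by move: u5; move: (dl _) (m - h)%:R => A Q; nra.
  rewrite -(cvg_shiftn n.+1).
  have E m : \sum_(k < m + n.+1) autocorr (y k) n = a n - a (n + m)%N - m%:R * dl (n + m)%N.
    by rewrite addnC addSn sumE.
  have h : a n - a (n + m)%N - m%:R * dl (n + m)%N @[m --> \oo] --> a n - 0 - 0.
    apply: cvgB => //; apply: cvgB; first exact: cvg_cst.
    have := a0; rewrite -(cvg_shiftn n).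
    by rewrite (funext (fun m => congr1 a (addnC m n))).
  by rewrite !subr0 in h; rewrite (funext E).
have y0 k : 0 <= autocorr (y k) 0.
  by apply: sumr_ge0 => i _; rewrite addn0 -expr2 sqr_ge0.
apply: nondecreasing_is_cvgn.
  by apply/nondecreasing_seqP => N; rewrite big_ord_recr lerDl.
exists (2 * a 1%N) => _ [N _ <-].
apply: (@le_trans _ _ (\sum_(k < (1 + N).+1) autocorr (y k) 0)).
  by rewrite add1n !big_ord_recr/= -addrA lerDl addr_ge0.
(* For [k >= 2] one has [k <= 2 * (k - 1)], so lag 0 is controlled by lag 1, whose partial sums are
   at most [a 1]. *)
apply: (@le_trans _ _ (2 * \sum_(k < (1 + N).+1) autocorr (y k) 1)).
  rewrite mulr_sumr; apply: ler_sum => k _; rewrite !yE; case: ltnP; first by rewrite mulr0.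
  move=> k2; rewrite mulrCA ler_wpM2l ?cvx// subn0 -natrM ler_nat.
  by rewrite mulnBr muln1 leq_subRL ?mul2n -?addnn ?leq_add2r// (leq_trans k2)// leq_addr.
rewrite sumE// ler_pM2l//.
have := a_ge0 (1 + N)%N isT; have := dl_ge0 (1 + N)%N isT.
move: (dl _) => A hA ha; have := mulr_ge0 (ler0n R N) hA; lra.
Qed.

End Sequences.

(** * The space [L^2] and its completeness *)

Section L2.
Context {R : realType} {d : measure_display} {X : measurableType d} (mu : probability X R).

Lemma Lfun2P (f : X -> R) : f \in Lfun mu 2%:E <->
  measurable_fun [set: X] f /\ (\int[mu]_x (f x ^+ 2)%:E < +oo)%E.
Proof.
split=> [fL|[mf fi]].
  split; first by move: fL; rewrite inE => /andP[]; rewrite inE.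
  exact: integrable_lty (Lfun2_integrable_sqr fL).
rewrite inE; apply/andP; split; rewrite inE//= /finite_norm unlock.
apply: poweR_lty; apply: le_lt_trans fi.
rewrite le_eqVlt; apply/predU1P; left; apply: eq_integral => x _ /=.
by rewrite powR_mulrn// real_normK// num_real.
Qed.

Lemma one_le_two : (1 <= 2%:E :> \bar R)%E.
Proof. by rewrite lee_fin; lra. Qed.

Local Notation L2 := (LfunType mu one_le_two).

Lemma integrable_mul (f g : L2) : mu.-integrable [set: X] (fun x => (f x * g x)%:E).
Proof.
by have /Lfun1_integrable := Lfun2_mul_Lfun1 (LfunP f) (LfunP g).
Qed.

Definition L2form (f g : L2) : R := \int[mu]_x (f x * g x).

Fact L2formC (f g : L2) : L2form f g = L2form g f.
Proof. by apply: eq_Rintegral => x _; rewrite mulrC. Qed.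

Fact L2formDl (f g h : L2) : L2form (f + g) h = L2form f h + L2form g h.
Proof.
rewrite /L2form -RintegralD//; try exact: integrable_mul.
by apply: eq_Rintegral => x _; rewrite -mulrDl.
Qed.

Fact L2formZl (a : R) (f g : L2) : L2form (a *: f) g = a * L2form f g.
Proof.
rewrite /L2form -RintegralZl//; last exact: integrable_mul.
by apply: eq_Rintegral => x _; rewrite mulrA.
Qed.

Fact L2form_ge0 (f : L2) : 0 <= L2form f f.
Proof. by apply: Rintegral_ge0 => x _; rewrite -expr2 sqr_ge0. Qed.

Definition L2inner := SemiInner L2formC L2formDl L2formZl L2form_ge0.

Lemma L2inner_sqrE (f : L2) : (L2inner f f)%:E = (\int[mu]_x (f x ^+ 2)%:E)%E.
Proof.
rewrite /= /L2form /Rintegral fineK; first by apply: eq_integral => x _; rewrite expr2.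
by apply: integrable_fin_num => //; exact: integrable_mul.
Qed.

(** Pointwise [|w| <= w ^+ 2 / c + c], and [mu] has total mass 1. *)
Lemma integral_normr_le (w : L2) (c : R) : 0 < c -> L2inner w w <= c ^+ 2 ->
  (\int[mu]_x `|w x|%:E <= (2 * c)%:E)%E.
Proof.
move=> c0 wc.
have mw : measurable_fun [set: X] (w : X -> R) by exact: measurable_funP.
have mw2 : measurable_fun [set: X] (EFin \o (fun x => w x ^+ 2)).
  by apply/measurable_EFinP; exact: measurable_funX.
apply: (@le_trans _ _ (\int[mu]_x ((c^-1)%:E * (w x ^+ 2)%:E + c%:E))%E).
  apply: ge0_le_integral => //.
  - by apply/measurable_EFinP; exact: measurableT_comp.
  - by apply: emeasurable_funD => //; exact: measurable_funeM.
  - move=> x _; rewrite -EFinM -EFinD lee_fin -real_normK ?num_real//.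
    rewrite -(ler_pM2l c0) mulrDr mulrA mulfV ?gt_eqF// mul1r.
    by have := sqr_ge0 (`|w x| - c); have := sqr_ge0 (`|w x| + c); nra.
rewrite ge0_integralD//; last 3 first.
- by move=> x _; rewrite -EFinM lee_fin mulr_ge0 ?sqr_ge0// invr_ge0 ltW.
- exact: measurable_funeM.
- by move=> x _; rewrite lee_fin ltW.
rewrite ge0_integralZl_EFin// ?invr_ge0 ?(ltW c0)//; last first.
  by move=> x _; rewrite lee_fin sqr_ge0.
rewrite -L2inner_sqrE integral_cst// [X in (_ + _ * X)%E](_ : _ = 1%E);
  last exact: probability_setT.
rewrite mule1 -EFinM -EFinD lee_fin.
rewrite (_ : 2 * c = c + c) ?lerD2r ?(mulrC c^-1) ?ler_pdivrMr // -?expr2//; ring.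
Qed.

Lemma limn_einf_le (a : nat -> \bar R) (c : \bar R) N :
  (forall n, (N <= n)%N -> (a n <= c)%E) -> (limn_einf a <= c)%E.
Proof.
move=> h; rewrite limn_einf_lim; apply: lime_le; first exact: is_cvg_einfs.
apply: nearW => n; apply: (@le_trans _ _ (a (maxn n N))); last by apply: h; exact: leq_maxr.
by apply: ereal_inf_lbound; exists (maxn n N) => //=; exact: leq_maxl.
Qed.

(** The increments have [L^1] norms at most [2 * 2^-1 ^+ k], so the sum of their absolute values has
    integral at most 4 and is finite almost everywhere. *)
Lemma ae_cvg_of_fast_cauchy (v : nat -> L2) :
  (forall k, L2inner (v k.+1 - v k) (v k.+1 - v k) <= (2^-1 ^+ k) ^+ 2) ->
  {ae mu, forall x, cvgn (fun k => v k x)}.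
Proof.
move=> vc; pose w k : L2 := v k.+1 - v k.
pose F x := (\sum_(k <oo) `|w k x|%:E)%E.
have w0 k x : (0 <= `|w k x|%:E)%E by rewrite lee_fin.
have mw k : measurable_fun [set: X] (EFin \o (fun x => `|w k x|)).
  by apply/measurable_EFinP; apply: measurableT_comp => //; exact: measurable_funP.
have mF : measurable_fun [set: X] F.
  apply: (@emeasurable_fun_cvg _ _ _ _ (fun n x => \sum_(0 <= k < n) `|w k x|%:E)%E) => [n|x _].
    exact: emeasurable_sum.
  by apply: is_cvg_nneseries.
have iF : mu.-integrable [set: X] F.
  apply/integrableP; split => //.
  under eq_integral do rewrite gee0_abs ?nneseries_ge0//.
  rewrite integral_nneseries//; apply: (@le_lt_trans _ _ (4%:E)); last exact: ltry.
  apply: lime_le; first by apply: is_cvg_nneseries => *; exact: integral_ge0.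
  apply: nearW => n; apply: (@le_trans _ _ (4 - 4 * 2^-1 ^+ n)%:E); last first.
    by rewrite lee_fin gerBl mulr_ge0// exprn_ge0// invr_ge0.
  elim: n => [|n IH]; first by rewrite big_geq// expr0 mulr1 subrr.
  rewrite big_nat_recr//=; have h := integral_normr_le (exprn_gt0 n _) (vc n).
  apply: le_trans (leeD IH (h _)) _; first by rewrite invr_gt0.
  by rewrite -EFinD lee_fin exprS; move: (2^-1 ^+ n) => t; lra.
have := integrable_ae measurableT iF; apply: filterS => x /(_ I) Ffin.
have cw : cvgn (series (fun k => w k x)).
  apply: normed_cvg; apply: nondecreasing_is_cvgn.
    apply/nondecreasing_seqP => n.
    change (\sum_(0 <= k < n) `|w k x| <= \sum_(0 <= k < n.+1) `|w k x|).
    by rewrite big_nat_recr//= lerDl.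
  exists (fine (F x)) => _ [n _ <-]; rewrite -lee_fin fineK// /series/= -sumEFin.
  exact: nneseries_lim_ge.
have -> : (fun k => v k x) = fun k => v 0 x + series (fun k => w k x) k.
  apply/funext; elim => [|k IH]; first by rewrite /series/= big_geq// addr0.
  by rewrite /series/= big_nat_recr//= addrA -IH addrC subrK.
by apply: is_cvgD => //; exact: is_cvg_cst.
Qed.

(** Riesz-Fischer: a fast subsequence converges almost everywhere, and Fatou's lemma shows that the
    whole sequence tends to its limit in [L^2]. *)
Lemma L2_complete : complete_semi L2inner.
Proof.
move=> u cu.
have /choice [n_ hn] : forall k, exists N, forall m m', (N <= m)%N -> (N <= m')%N ->
    L2inner (u m - u m') (u m - u m') < (2^-1 ^+ k) ^+ 2.
  by move=> k; apply: cu; rewrite !exprn_gt0// invr_gt0.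
(* Summing the thresholds makes [s] nondecreasing, above every [n_ k] and at least [k]. *)
pose s k := (\sum_(i < k.+1) n_ i + k)%N.
have s_ge k : (k <= s k)%N by exact: leq_addl.
have s_n k : (n_ k <= s k)%N by rewrite /s big_ord_recr/= -addnA addnCA leq_addr.
have sS k : (s k <= s k.+1)%N by rewrite /s [in leqRHS]big_ord_recr/= leq_add// leq_addr.
pose v k := u (s k).
have cv : {ae mu, forall x, cvgn (fun k => v k x)}.
  apply: ae_cvg_of_fast_cauchy => k; apply/ltW/hn => //.
  exact: leq_trans (s_n k) (sS k).
have mv k : measurable_fun [set: X] (v k : X -> R) by exact: measurable_funP.
(* The upper limit is measurable on all of [X], and it is the limit wherever the subsequence
   converges. *)
pose V x := fine (limn_esup (fun k => (v k x)%:E)).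
have mV : measurable_fun [set: X] V.
  apply: measurableT_comp => //; apply: measurable_fun_limn_esup => k.
  by apply/measurable_EFinP.
have VE x : cvgn (fun k => v k x) -> v k x @[k --> \oo] --> V x.
  move=> cvx; suff -> : V x = limn (fun k => v k x) by [].
  have /cvg_limn_einf_sup[_ h] : (v k x)%:E @[k --> \oo] --> (limn (fun k => v k x))%:E.
    by apply/cvg_EFin => //; exact: nearW.
  by rewrite /V h.
have key m (e : R) N : (forall k, (N <= k)%N -> L2inner (v k - u m) (v k - u m) <= e) ->
    (\int[mu]_x ((V x - u m x) ^+ 2)%:E <= e%:E)%E.
  move=> hN; pose f k x := ((v k x - u m x) ^+ 2)%:E.
  have mu_m : measurable_fun [set: X] (u m : X -> R) by exact: measurable_funP.
  have mf k : measurable_fun [set: X] (f k).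
    by apply/measurable_EFinP; apply: measurable_funX; exact: measurable_funB.
  have f0 k x : [set: X] x -> (0 <= f k x)%E by rewrite lee_fin sqr_ge0.
  have -> : (\int[mu]_x ((V x - u m x) ^+ 2)%:E = \int[mu]_x limn_einf (f ^~ x))%E.
    apply: ge0_ae_eq_integral => //.
    - by apply/measurable_EFinP; apply: measurable_funX; exact: measurable_funB.
    - apply: measurableT_comp => //; apply: measurable_fun_limn_esup => k.
      exact: measurableT_comp.
    - by move=> x _; rewrite lee_fin sqr_ge0.
    - move=> x _; rewrite limn_einf_lim; apply: lime_ge; first exact: is_cvg_einfs.
      by apply: nearW => n; apply: le_ereal_inf_tmp => _ [k _ <-]; exact: f0.
    - apply: filterS cv => x cvx _; apply/esym.
      have h : f k x @[k --> \oo] --> ((V x - u m x) ^+ 2)%:E.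
        apply/cvg_EFin; first exact: nearW.
        apply: (@cvgM R^o); apply: cvgB; (try exact: VE); exact: cvg_cst.
      by have [-> _] := cvg_limn_einf_sup h.
  apply: le_trans (fatou mu measurableT mf f0) _.
  by apply: (@limn_einf_le _ _ N) => k Nk; rewrite /f -(L2inner_sqrE (v k - u m)) lee_fin hN.
have keyN e : 0 < e -> exists N, forall m, (N <= m)%N ->
    (\int[mu]_x ((V x - u m x) ^+ 2)%:E <= e%:E)%E.
  move=> e0; have [N hN] := cu e e0; exists N => m Nm; apply: (key m e N) => k Nk.
  by apply/ltW/hN => //; exact: leq_trans (s_ge k).
have [N1 hN1] := keyN 1 ltr01.
have VL : (fun x => V x - u N1 x) \in Lfun mu 2%:E.
  apply/Lfun2P; split; first by apply: measurable_funB => //; exact: measurable_funP.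
  by apply: le_lt_trans (hN1 _ (leqnn _)) _; exact: ltry.
(* Only [V - u N1] is known to be square integrable so far; adding [u N1] back puts [V] in [L^2]. *)
pose z : L2 := Lfun_Sub one_le_two VL + u N1.
have zE x : z x = V x by rewrite /z/= subrK.
exists z; apply: cvg_semi_sqr => e e0; have e2 : 0 < e / 2 by lra.
have [N hN] := keyN _ e2; exists N => n Nn; apply: (@le_lt_trans _ _ (e / 2)); last by lra.
rewrite -lee_fin L2inner_sqrE; apply: le_trans (hN n Nn).
rewrite le_eqVlt; apply/predU1P; left; apply: eq_integral => x _; congr EFin.
have -> : (u n - z) x = u n x - z x by [].
by rewrite zE; ring.
Qed.

End L2.

(** * The Koopman operator and centered functions *)

Section Koopman.
Context {R : realType} {d : measure_display} {X : measurableType d} (mu : probability X R).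
Variable T : X -> X.
Hypothesis mpT : measure_preserving mu T.

Local Notation L2 := (LfunType mu (@one_le_two R)).
Local Notation B := (L2inner mu).

Let mT : measurable_fun [set: X] T.
Proof. by case: mpT. Qed.

Let integral_pushforwardE (g : X -> \bar R) :
  (\int[pushforward mu T]_x g x = \int[mu]_x g x)%E.
Proof. by apply: eq_measure_integral => A mA _; case: mpT => _; apply. Qed.

Lemma measure_preserving_ge0_integral (g : X -> \bar R) : measurable_fun [set: X] g ->
  (forall x, 0 <= g x)%E -> (\int[mu]_x g (T x) = \int[mu]_x g x)%E.
Proof.
move=> mg g0; rewrite -[RHS]integral_pushforwardE ge0_integral_pushforward//.
Qed.

Lemma measure_preserving_integral (g : X -> \bar R) : mu.-integrable [set: X] g ->
  (\int[mu]_x g (T x) = \int[mu]_x g x)%E.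
Proof.
move=> /integrableP[mg ig]; rewrite -[RHS]integral_pushforwardE integral_pushforward//.
rewrite preimage_setT; apply/integrableP; split; first exact: measurableT_comp.
rewrite (measure_preserving_ge0_integral (g := fun x => `|g x|%E))//.
exact: measurableT_comp.
Qed.

Lemma Lfun2_comp (f : X -> R) : f \in Lfun mu 2%:E -> f \o T \in Lfun mu 2%:E.
Proof.
move=> /Lfun2P[mf fi]; apply/Lfun2P; split; first exact: measurableT_comp.
rewrite (measure_preserving_ge0_integral (g := fun x => (f x ^+ 2)%:E))//.
- by apply/measurable_EFinP; exact: measurable_funX.
- by move=> x; rewrite lee_fin sqr_ge0.
Qed.

Definition koopman (f : L2) : L2 := Lfun_Sub (@one_le_two R) (Lfun2_comp (LfunP f)).

Lemma koopman_linear : linear koopman.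
Proof. by move=> a f g; apply/LfuneqP. Qed.

Lemma koopman_iso (f g : L2) : B (koopman f) (koopman g) = B f g.
Proof.
rewrite /= /L2form /Rintegral; congr fine.
by rewrite -(measure_preserving_integral (integrable_mul f g)).
Qed.

Lemma iter_koopmanE n (f : L2) x : iter n koopman f x = f (iter n T x).
Proof. by elim: n x => // n IH x; rewrite iterS [LHS]IH -iterSr. Qed.

Lemma correlationE (f : L2) n : correlation mu T f n = B f (iter n koopman f).
Proof. by apply: eq_Rintegral => x _; rewrite iter_koopmanE. Qed.

Definition L2one : L2 := Lfun_Sub (@one_le_two R) (Lfun_cst mu 1 2).

Lemma L2inner_one (f : L2) : B f L2one = \int[mu]_x f x.
Proof. by apply: eq_Rintegral => x _; rewrite mulr1. Qed.

Lemma koopman_one (f : L2) : B (koopman f) L2one = B f L2one.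
Proof.
rewrite -[RHS]koopman_iso; congr (B _ _); exact/LfuneqP.
Qed.

Lemma L2inner_oneone : B L2one L2one = 1.
Proof.
rewrite L2inner_one; apply: etrans (Rintegral_cst mu measurableT 1) _.
have mu1 : (mu [set: X] = 1)%E by exact: probability_setT.
by rewrite mul1r; exact: (congr1 fine mu1).
Qed.

Lemma L2inner_eq0 (f : L2) : B f f = 0 <-> {ae mu, forall x, f x = 0}.
Proof.
have mf2 : measurable_fun [set: X] (fun x => (f x ^+ 2)%:E).
  by apply/measurable_EFinP; apply: measurable_funX; exact: measurable_funP.
have E : (\int[mu]_x `|(f x ^+ 2)%:E| = (B f f)%:E)%E.
  by rewrite L2inner_sqrE; apply: eq_integral => x _; rewrite gee0_abs// lee_fin sqr_ge0.
have [h1 h2] := ae_eq_integral_abs mu measurableT mf2.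
rewrite E in h1 h2; split=> [f0|f0].
  have : ae_eq mu [set: X] (fun x => (f x ^+ 2)%:E) (cst 0%E) by apply: h1; rewrite f0.
  apply: filterS => x /(_ I) /= /eqP.
  by rewrite eqe sqrf_eq0 => /eqP.
apply: EFin_inj; apply: h2; apply: filterS f0 => x fx _ /=.
by rewrite fx expr0n.
Qed.

(** A constant [c] equal to [f] almost everywhere must be its mean, because the null vector [f - c]
    pairs to 0 with the function 1. *)
Lemma nonconstant_center (f : L2) : nonconstant mu f <->
  0 < B (f - (\int[mu]_x f x) *: L2one) (f - (\int[mu]_x f x) *: L2one).
Proof.
set m := \int[mu]_x f x; split => [nf|fp [c fc]].
  rewrite lt_def form_ge0 andbT; apply/eqP => /L2inner_eq0 h; apply: nf.
  exists m; apply: filterS h => x; change (f x - m * 1 = 0 -> f x = m).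
  by rewrite mulr1 => /eqP; rewrite subr_eq0 => /eqP.
have g0 : B (f - c *: L2one) (f - c *: L2one) = 0.
  apply/L2inner_eq0; apply: filterS fc => x fx; change (f x - c * 1 = 0).
  by rewrite fx mulr1 subrr.
have mc : m = c.
  apply/eqP; rewrite -subr_eq0; have := form_null_r (L2one) g0.
  by rewrite formC formBl formZl L2inner_oneone mulr1 L2inner_one => ->.
by move: fp; rewrite mc g0 ltxx.
Qed.

Lemma koopman_iter_one (f : L2) n : B L2one (iter n koopman f) = B f L2one.
Proof. by rewrite formC; elim: n => [//|n IH]; rewrite iterS koopman_one. Qed.

Lemma iter_koopman_center (f : L2) (m : R) n :
  iter n koopman (f - m *: L2one) = iter n koopman f - m *: L2one.
Proof.
by apply/LfuneqP => x; rewrite iter_koopmanE -[RHS]/(iter n koopman f x - m * 1) iter_koopmanE.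
Qed.

Lemma center_correlation (f : L2) n (m := \int[mu]_x f x) :
  B (f - m *: L2one) (iter n koopman (f - m *: L2one)) = correlation mu T f n - m ^+ 2.
Proof.
rewrite iter_koopman_center correlationE !(formBl, formBr, formZl, formZr).
by rewrite koopman_iter_one L2inner_oneone L2inner_one -/m; ring.
Qed.

Lemma center_mean (f : L2) (m := \int[mu]_x f x) : B (f - m *: L2one) L2one = 0.
Proof. by rewrite formBl formZl L2inner_oneone L2inner_one mulr1 subrr. Qed.

(** Yields nonconstancy from a correlation that differs from the squared mean: if the centered
    function is null, so are all its correlations. *)
Lemma center_stationary (f : L2) (m := \int[mu]_x f x) n : (0 < n)%N ->
  nonconstant mu f \/ correlation mu T f n = m ^+ 2.
Proof.
move=> n0; set g := f - m *: L2one.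
have [g0|gN0] := eqVneq (B g g) 0; last first.
  by left; apply/nonconstant_center; rewrite lt_def gN0 form_ge0.
right; apply/eqP; rewrite -subr_eq0 -center_correlation -/m -/g.
by rewrite formC (form_null_r _ g0).
Qed.

End Koopman.

(** * From an under-recurrent function to prescribed correlations *)

(** All terms are positive, so a function whose centered correlations are this sequence is strictly
    over-recurrent. *)
Lemma geometric_summable (R : realType) : absolutely_summable (fun n => 2^-1 ^+ n : R).
Proof.
rewrite /absolutely_summable /summable -(@nneseries_esum _ _ (fun n => (1 <= n)%N))//.
apply: (@le_lt_trans _ _ (2%:E)); last exact: ltry.
have p0 n : (0 : R) <= 2^-1 ^+ n by rewrite exprn_ge0// invr_ge0.
apply: lime_le; first exact: is_cvg_nneseries_cond.
apply: nearW => n; apply: (@le_trans _ _ (2 - 2 * 2^-1 ^+ n)%:E); last first.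
  by rewrite lee_fin gerBl mulr_ge0.
elim: n => [|n IH]; first by rewrite big_geq// expr0 mulr1 subrr.
rewrite big_mkcond big_nat_recr//= -big_mkcond/=.
apply: (@le_trans _ _ ((2 - 2 * 2^-1 ^+ n)%:E + (2^-1 ^+ n)%:E)%E).
  by apply: leeD => //; case: ifP => _; rewrite ?lee_fin// ger0_norm.
by rewrite -EFinD lee_fin exprS; move: (2^-1 ^+ n) => t; lra.
Qed.

Theorem corollary2p6 (R : realType) (d : measure_display)
    (X : measurableType d) (mu : probability X R) (T : X -> X)
    (mpT : measure_preserving mu T)
    (under : exists f : X -> R, under_recurrent mu T f) :
  (exists f : X -> R, strictly_over_recurrent mu T f) /\
  (forall a : nat -> R,
     absolutely_summable a \/ decreases_convexly_to_0 a ->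
     exists2 f : X -> R, f \in Lfun mu 2%:E &
       forall n : nat, (1 <= n)%N ->
         correlation mu T f n - (\int[mu]_x f x) ^+ 2 = a n).
Proof.
have real (a : nat -> R) : absolutely_summable a \/ decreases_convexly_to_0 a ->
    exists2 f : X -> R, f \in Lfun mu 2%:E &
      forall n : nat, (1 <= n)%N -> correlation mu T f n - (\int[mu]_x f x) ^+ 2 = a n.
  move=> ha; have [f0 [fL fN fU]] := under.
  pose f : LfunType mu (@one_le_two R) := Lfun_Sub (@one_le_two R) fL.
  pose g := f - (\int[mu]_x f x) *: L2one mu.
  have [y [cy ya]] : exists y : nat -> {poly R},
      cvgn (fun N => \sum_(k < N) autocorr (y k) 0) /\
      forall n, (0 < n)%N -> \sum_(k < N) autocorr (y k) n @[N --> \oo] --> a n.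
    by case: ha => [/summable_blocks|/convex_blocks].
  have [F [F1 Fa]] := correlation_realization (L2_complete (mu := mu)) (koopman_linear mpT)
    (koopman_iso mpT) (koopman_one mpT) (center_mean f)
    ((nonconstant_center f).1 fN)
    (* Centering turns under-recurrence of [f] into nonpositivity of the correlations of [g]. *)
    (fun n n0 => eq_ind_r (fun t => t <= 0) (etrans (subr_le0 _ _) (fU n n0))
      (center_correlation mpT f n)) cy ya.
  exists F; first exact: LfunP.
  by move=> n n0; rewrite -L2inner_one F1 (correlationE mpT) Fa// expr0n subr0.
split; last exact: real.
have [F FL FE] := real _ (or_introl (geometric_summable R)).
have lt n : (1 <= n)%N -> (\int[mu]_x F x) ^+ 2 < correlation mu T F n.
  by move=> n1; rewrite -subr_gt0 FE// exprn_gt0// invr_gt0.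
exists F; split => //.
(* The strict inequality at lag 1 excludes the constant case. *)
have := center_stationary mpT (Lfun_Sub (@one_le_two R) FL) (ltn0Sn 0).
by case=> // /eqP; rewrite gt_eqF// lt.
Qed.
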